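(* For every integer $k\ge 0$, the subgraph of complete lines $C_k$ of $\Gamma_k$ has exactly $2\cdot 6^k-4^k$ vertices and satisfies $cut^{1/2}(C_k)\ge 2^{k-1}$. Moreover, the infinite graph $S=\bigcup_{k\ge 0}\Gamma_k$ satisfies $$sep_S(n)\asymp n^{\log(2)/\log(6)}.$$
   Context: For a non-negative integer $x$ write $x=\sum_{i\ge 0}x_i3^i$ with $x_i\in\{0,1,2\}$ (base 3 digits). $\Gamma_k$ is the graph with vertex set $V_k=\{(x,y)\in\mathbb{Z}^2\cap[0,3^k)^2 : \text{there is no } i \text{ with } x_i=y_i=1\}$ and edges $(x,y)(x',y')$ whenever $|x-x'|+|y-y'|=1$. The graphs $\Gamma_k$ are nested, and $S=\bigcup_{k\ge 0}\Gamma_k$ is their union. Vertical and horizontal lines are $V_x=\{x\}\times\mathbb{Z}$ and $H_y=\mathbb{Z}\times\{y\}$, for integers $x,y$. A vertical or horizontal line $L$ is complete in $\Gamma_k$ if $\Gamma_k\cap L$ (the subgraph of $\Gamma_k$ induced on the vertices lying on $L$) is nonempty and connected. The subgraph of complete lines $C_k$ is the union of the subgraphs $\Gamma_k\cap L$ over all lines $L$ complete in $\Gamma_k$. For a finite graph $G$, $|G|$ is its number of vertices, $L(G)$ is a largest connected component of $G$, and for $\epsilon\in(0,1)$, $cut^{\epsilon}(G)=\min\{|T| : T\subseteq V(G),\ |L(G-T)|\le\epsilon|G|\}$, where $G-T$ is the graph obtained by deleting the vertices in $T$. For an infinite graph $X$, $sep^{\epsilon}_X(n)=\sup\{cut^{\epsilon}(G)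 : G\le X \text{ a finite subgraph},\ |G|\le n\}$. We write $sep_X=sep_X^{1/2}$ (up to $\asymp$ the choice of $\epsilon\in(0,1)$ does not matter). For functions $f,g$ of $n\in\mathbb{Z}_{\ge 1}$, $f\preceq g$ means $f(n)=\mathcal{O}(g(n))$, and $f\asymp g$ means $f\preceq g$ and $g\preceq f$. *)

(* Defs.v *)
From HB Require Import structures.
From Stdlib Require Import Relation_Operators.
From mathcomp Require Import all_boot all_order all_algebra finmap.
From mathcomp Require Import all_classical all_reals all_analysis.

Set Implicit Arguments.
Unset Strict Implicit.
Unset Printing Implicit Defensive.

Import Order.TTheory GRing.Theory Num.Theory.
Import numFieldNormedType.Exports.

Local Open Scope classical_set_scope.
Local Open Scope ring_scope.

(* Simple undirected graphs, finite or infinite, with vertices in T. A graph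
   carries its own adjacency relation, so subgraphs need not be induced. *)
Record graph (T : choiceType) := Graph {
  vertices : set T;
  adj : T -> T -> Prop;
  adj_sym : forall u v, adj u v -> adj v u;
  adj_irrefl : forall u, ~ adj u u;
  adj_vertices : forall u v, adj u v -> vertices u
}.

Section Graphs.
Variable T : choiceType.
Implicit Types G X : graph T.

Definition subgraph G X : Prop :=
  vertices G `<=` vertices X /\ (forall u v, adj G u v -> adj X u v).

Program Definition induced_subgraph G (A : set T) : graph T :=
  @Graph T (vertices G `&` A) (fun u v => [/\ adj G u v, A u & A v]) _ _ _.
Next Obligation. by move=> G A u v [/adj_sym]. Qed.
Next Obligation. by move=> G A u [/adj_irrefl]. Qed.
Next Obligation. by move=> G A u v [/adj_vertices]. Qed.

Definition delete_vertices G (A : set T) : graph T := induced_subgraph G (~` A).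

Program Definition graph_union (I : Type) (P : set I) (F : I -> graph T)
    : graph T :=
  @Graph T (\bigcup_(i in P) vertices (F i))
    (fun u v => exists2 i, P i & adj (F i) u v) _ _ _.
Next Obligation. by move=> I P F u v [i Pi /adj_sym]; exists i. Qed.
Next Obligation. by move=> I P F u [i _ /adj_irrefl]. Qed.
Next Obligation. by move=> I P F u v [i Pi /adj_vertices]; exists i. Qed.

Definition reachable G : T -> T -> Prop := clos_refl_trans T (adj G).

Definition connected_graph G : Prop :=
  forall u v, vertices G u -> vertices G v -> reachable G u v.

Definition component G (u : T) : set T :=
  [set v | vertices G v /\ reachable G u v].

(* [graph_order] and everything built on it is meant for finite graphs only:
   [fset_set] sends an infinite set to the empty one. *)
Definition graph_order G : nat := #|` fset_set (vertices G)|.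

(* The number of vertices of a largest connected component; 0 if G is empty. *)
Definition largest_component_order G : nat :=
  \max_(u <- fset_set (vertices G)) #|` fset_set (component G u)|.

(* The default value [graph_order G] of the minimum is the one attained at the
   admissible set A = V(G). *)
Definition cut_size (R : realType) (eps : R) G : nat :=
  \big[minn/graph_order G]_(A <- fpowerset (fset_set (vertices G))
     | (largest_component_order (delete_vertices G [set` A]))%:R
         <= eps * (graph_order G)%:R)
    #|` A|.

Definition finite_subgraphs X (n : nat) : set (graph T) :=
  [set G | [/\ subgraph G X, finite_set (vertices G) & (graph_order G <= n)%N]].

Definition sep_profile (R : realType) (eps : R) X (n : nat) : R :=
  sup [set (cut_size eps G)%:R | G in finite_subgraphs X n].

(* The supremum in [sep_profile] is that of a nonempty bounded set, hence never the
   junk value of [sup]. *)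
Lemma has_sup_sep_profile (R : realType) (eps : R) X (n : nat) :
  has_sup [set ((cut_size eps G)%:R : R) | G in finite_subgraphs X n].
Proof.
split.
  exists (cut_size eps (induced_subgraph X set0))%:R; exists (induced_subgraph X set0) => //.
  rewrite /finite_subgraphs /graph_order /= setI0 fset_set0 cardfs0.
  by split => //; split=> [u []|u v []].
exists n%:R => _ [G [_ _ Gn] <-]; rewrite ler_nat (leq_trans _ Gn)// /cut_size.
by elim/big_rec: _ => // A m _ mG; rewrite geq_min mG orbT.
Qed.

End Graphs.

Program Definition grid_graph (A : set (int * int)) : graph (int * int)%type :=
  @Graph (int * int)%type A
    (fun p q => [/\ A p, A q & (`|p.1 - q.1| + `|p.2 - q.2| = 1)%N]) _ _ _.
Next Obligation.
by move=> A p q [Ap Aq pq]; split=> //; rewrite distnC (distnC q.2).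
Qed.
Next Obligation. by move=> A p [_ _]; rewrite !subrr. Qed.
Next Obligation. by move=> A p q []. Qed.

(* The coefficient of 3 ^ i in the base 3 expansion of x, for x >= 0. *)
Definition digit3 (i : nat) (x : int) : nat := ((`|x| %/ 3 ^ i) %% 3)%N.

Definition Gamma (k : nat) : graph (int * int)%type :=
  grid_graph [set p : int * int |
    [/\ 0 <= p.1 < 3 ^+ k, 0 <= p.2 < 3 ^+ k &
        ~ exists i : nat, digit3 i p.1 = 1%N /\ digit3 i p.2 = 1%N]].

Definition Sgraph : graph (int * int)%type := graph_union [set: nat] Gamma.

Definition vline (x : int) : set (int * int) := [set p | p.1 = x].
Definition hline (y : int) : set (int * int) := [set p | p.2 = y].

Definition is_line (L : set (int * int)) : Prop :=
  (exists x, L = vline x) \/ (exists y, L = hline y).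

Definition complete_line (k : nat) (L : set (int * int)) : Prop :=
  [/\ is_line L, vertices (induced_subgraph (Gamma k) L) !=set0 &
      connected_graph (induced_subgraph (Gamma k) L)].

(* C_k is in general not an induced subgraph of Gamma k: an edge belongs to
   it only if the line through that edge is complete. *)
Definition complete_lines_graph (k : nat) : graph (int * int)%type :=
  graph_union [set L | complete_line k L] (fun L => induced_subgraph (Gamma k) L).

Definition asymp (R : realType) (f g : nat -> R) : Prop :=
  (f : nat -> R^o) =O_\oo (g : nat -> R^o) /\
  (g : nat -> R^o) =O_\oo (f : nat -> R^o).

(* Main.v *)
(* Lower bound. The complete vertical lines of Gamma_k are those whose abscissa
   has no base 3 digit 1, and likewise for horizontal lines. There are 2^k of
   each kind, and every vertical one meets every horizontal one, so the lines
   missed by a set of fewer than 2^(k-1) vertices, more than half of them in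
   each direction, lie in a single component, which is too large.

   Upper bound. A line whose coordinate ends in j digits 1 meets the carpet in
   only 2^j points per segment of length 3^j. For fixed j these lines form a
   grid of mesh 3^j, and the grid of level j + 1 is contained in that of level j.
   Let G have n <= 6^k vertices. If some cell of level at most k contains more than
   half of G, take one of minimal level j + 1 and delete the O(2^j) points of
   the grid of level j in its closure. Otherwise, by averaging over the residues
   modulo 3^k, some translate of the grid of level k meets G in at most 2 * 2^k
   points: delete these and, if a cell of the translate still contains more than
   half of G, also the O(2^k) points of the original grid of level k in it. *)

Require Import Defs.
From mathcomp Require Import all_boot all_order all_algebra finmap.
From mathcomp Require Import all_classical all_reals all_analysis.
From mathcomp Require Import zify.
From Stdlib Require Import Relation_Operators Operators_Properties.

Set Implicit Arguments.
Unset Strict Implicit.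
Unset Printing Implicit Defensive.

Import Order.TTheory GRing.Theory Num.Theory.
Import numFieldNormedType.Exports.

Local Open Scope fset_scope.
Local Open Scope nat_scope.

(** * Base 3 expansions without the digit 1 *)

Lemma uniq_append_digits (s : seq nat) :
  uniq s -> uniq [seq 3 * e + d | e <- s, d <- [:: 0; 2]].
Proof.
move=> us; apply: allpairs_uniq => // u v.
move=> /allpairsP[p [_ hp ->]] /allpairsP[p' [_ hp' ->]] /=; move: hp hp'.
by rewrite !inE => /orP[]/eqP-> /orP[]/eqP-> eq; congr pair; lia.
Qed.

Fixpoint even_digits (k : nat) : seq nat :=
  if k is k'.+1 then [seq 3 * e + d | e <- even_digits k', d <- [:: 0; 2]]
  else [:: 0].

Definition no_ones (k x : nat) : bool :=
  all (fun i => (x %/ 3 ^ i) %% 3 != 1) (iota 0 k).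

Lemma no_onesP k x :
  reflect (forall i, i < k -> (x %/ 3 ^ i) %% 3 <> 1) (no_ones k x).
Proof.
apply: (iffP allP) => [h i ik|h i].
  by apply/eqP/h; rewrite mem_iota.
by rewrite mem_iota => ik; apply/eqP/h.
Qed.

Lemma digitS i x : (x %/ 3 ^ i.+1) %% 3 = ((x %/ 3) %/ 3 ^ i) %% 3.
Proof. by rewrite expnS divnMA. Qed.

Lemma no_onesS k x : no_ones k.+1 x = (x %% 3 != 1) && no_ones k (x %/ 3).
Proof.
rewrite /no_ones /= expn0 divn1; congr andb.
rewrite -[1]/(1 + 0) iotaDl all_map; apply: eq_all => i /=.
by rewrite add1n digitS.
Qed.

Lemma even_digitsS k : even_digits k.+1 =
  [seq 3 * e + d | e <- even_digits k, d <- [:: 0; 2]].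
Proof. by []. Qed.

Lemma size_even_digits k : size (even_digits k) = 2 ^ k.
Proof.
by elim: k => // k IH; rewrite even_digitsS size_allpairs IH expnS mulnC.
Qed.

Lemma uniq_even_digits k : uniq (even_digits k).
Proof. by elim: k => // k /uniq_append_digits. Qed.

Lemma mem_even_digits k x : (x \in even_digits k) = (x < 3 ^ k) && no_ones k x.
Proof.
elim: k x => [|k IH] x; first by rewrite inE andbT; case: x.
rewrite no_onesS even_digitsS expnS.
apply/allpairsP/idP => [[[e d] /= [+ + ->]]|].
  rewrite IH => /andP[ek ne] d2.
  have dlt : d < 3 by move: d2; rewrite !inE => /orP[]/eqP->.
  rewrite mulnC divnMDl // divn_small // addn0 ne modnMDl modn_small // andbT.
  by apply/andP; split; [lia|move: d2; rewrite !inE => /orP[]/eqP->].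
move=> /and3P[xk x1 nx]; exists (x %/ 3, x %% 3); split => /=.
- by rewrite IH nx andbT; lia.
- by have := ltn_pmod x (isT : 0 < 3); case: (x %% 3) x1 => [|[|[|?]]].
- by rewrite {1}(divn_eq x 3) mulnC.
Qed.

Lemma no_ones_split k x : no_ones k x ->
  exists t e, x = 3 ^ k * t + e /\ e \in even_digits k.
Proof.
move=> nx; exists (x %/ 3 ^ k), (x %% 3 ^ k); split.
  by rewrite mulnC -divn_eq.
rewrite mem_even_digits ltn_mod expn_gt0 /=.
elim: k x nx => [//|k IH] x; rewrite !no_onesS => /andP[x1 /IH].
have -> : x %% 3 ^ k.+1 %/ 3 = x %/ 3 %% 3 ^ k by rewrite modn_divl expnSr.
have -> // : x %% 3 ^ k.+1 %% 3 = x %% 3.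
  by rewrite modn_dvdm // expnS dvdn_mulr.
by rewrite x1.
Qed.

(** * Coordinates ending in ones, and translated grids *)

(** The number (3 ^ k - 1) / 2, written with k digits 1 in base 3. *)
Fixpoint ones (k : nat) : nat := if k is k'.+1 then 3 * ones k' + 1 else 0.

Lemma onesE k : ones k + ones k + 1 = 3 ^ k.
Proof. by elim: k => //= k IH; rewrite expnS; lia. Qed.

(** A digit 1 of y among the j lowest positions would coincide with a digit 1 of x. *)
Lemma ones_no_ones j q x y : x = 3 ^ j * q + ones j ->
  (forall i, ~ ((x %/ 3 ^ i) %% 3 = 1 /\ (y %/ 3 ^ i) %% 3 = 1)) ->
  no_ones j y.
Proof.
elim: j q x y => [//|j IH] q x y /= xE xy; rewrite no_onesS.
have xE' : x = 3 * (3 ^ j * q + ones j) + 1 by rewrite xE expnS; lia.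
apply/andP; split.
  apply/eqP => y1; apply: (xy 0); rewrite expn0 !divn1; split=> //.
  by rewrite xE' mulnC modnMDl.
apply: (IH q (x %/ 3)); first by rewrite xE' mulnC divnMDl //= addn0.
by move=> i; have := xy i.+1; rewrite !digitS.
Qed.

(* The lines of the grid of mesh M and offset o are the x with M %| x + o; since
   ones j + (ones j).+1 = 3 ^ j, the grid of mesh 3 ^ j and offset (ones j).+1
   consists of the x ending in j ones. *)
Lemma grid_step M o x y : 0 < M -> x <= y.+1 -> y <= x.+1 ->
  ~~ (M %| x + o) -> ~~ (M %| y + o) -> (x + o) %/ M = (y + o) %/ M.
Proof.
move=> M0; wlog: x y / x <= y => [wl xy yx hx hy|].
  by case/orP: (leq_total x y) => h; [|apply/esym]; apply: wl.
move=> xy _ yx _; have [->//|->] : y = x \/ y = x.+1 by lia.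
by rewrite addSn divnS // => /negbTE->.
Qed.

(** A neighbour of a point strictly inside a cell may land on the boundary, on either side, but no
    further; hence both bounds are non-strict. *)
Lemma grid_near M o x y : 0 < M -> x <= y.+1 -> y <= x.+1 -> ~~ (M %| x + o) ->
  M * ((x + o) %/ M) <= y + o <= M * ((x + o) %/ M) + M.
Proof.
move=> M0 xy yx; rewrite /dvdn -lt0n => r0.
have := divn_eq (x + o) M; have := ltn_pmod (x + o) M0; rewrite mulnC.
by move: (M * _) => z; lia.
Qed.

(** The window need not be aligned with the multiples of M, hence p + 1 quotients for a length of p
    * M. *)
Lemma div_range M z w p : 0 < M -> z <= w < z + p * M ->
  w %/ M \in iota (z %/ M) p.+1.
Proof.
move=> M0 /andP[zw wz]; rewrite mem_iota leq_div2r //= addnS ltnS.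
by rewrite addnC -(divnMDl p z M0) leq_div2r // addnC ltnW.
Qed.

(** The two offsets differ by exactly 3 ^ j, since [ones j.+1] is [3 * ones j + 1]. *)
Lemma ones_grid_refine j x :
  3 ^ j.+1 %| x + (ones j.+1).+1 -> 3 ^ j %| x + (ones j).+1.
Proof.
move=> h; have : 3 ^ j %| x + (ones j.+1).+1.
  by apply: dvdn_trans h; rewrite expnS dvdn_mull.
have -> : x + (ones j.+1).+1 = (x + (ones j).+1) + 3 ^ j.
  by rewrite -(onesE j) /=; lia.
by rewrite dvdn_addl.
Qed.

Lemma ones_gridP j x : 3 ^ j %| x + (ones j).+1 ->
  exists q, x = 3 ^ j * q + ones j.
Proof.
move=> /dvdnP[[|q] xE]; first by lia.
by exists q; have := onesE j; lia.
Qed.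

(** Every x is counted for exactly one r, namely [x %% M], so the M counts add up to [size s]. *)
Lemma averaging (s : seq nat) M t : 0 < M -> size s <= M * t ->
  exists2 r, r < M & count (fun x => M %| x + (M - r)) s <= t.
Proof.
move=> M0 st; apply: contrapT => h.
have {}h r : r < M -> t.+1 <= count (fun x => M %| x + (M - r)) s.
  by move=> rM; rewrite ltnNge; apply/negP => ct; apply: h; exists r.
have : \sum_(r < M) t.+1 <= \sum_(r < M) count (fun x => M %| x + (M - r)) s.
  by apply: leq_sum => r _; apply: h.
rewrite sum_nat_const card_ord => h1.
suff: \sum_(r < M) count (fun x => M %| x + (M - r)) s <= size s.
  by move: h1; nia.
under eq_bigr do rewrite -sum1_count big_mkcond.
rewrite exchange_big /= -sum1_size leq_sum // => x _.
rewrite (bigD1 (Ordinal (ltn_pmod x M0))) //= big1 ?addn0; first by case: ifP.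
move=> r rx; case: ifP => // dv; case/eqP: rx; apply/val_inj => /=.
have rM := ltn_ord r.
have : x + (M - r) + r = r %[mod M] by move/eqP: dv => dv; rewrite -modnDml dv.
by rewrite -addnA subnK ?(ltnW rM) // modnDr => ->; rewrite modn_small.
Qed.

(** * Bounds on cut sizes *)

Lemma bigminn_le (I : eqType) (s : seq I) (P : pred I) (F : I -> nat) d i :
  i \in s -> P i -> \big[minn/d]_(j <- s | P j) F j <= F i.
Proof.
elim: s => //= a s IH; rewrite inE big_cons => /orP[/eqP<- ->|/IH{}IH /IH h].
  by rewrite geq_minl.
by case: ifP => // _; rewrite geq_min h orbT.
Qed.

Lemma leq_bigminn (I : eqType) (s : seq I) (P : pred I) (F : I -> nat) d m :
  m <= d -> (forall i, i \in s -> P i -> m <= F i) ->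
  m <= \big[minn/d]_(j <- s | P j) F j.
Proof.
move=> md h; rewrite big_seq_cond; elim/big_rec: _ => // i n /andP[si Pi] mn.
by rewrite leq_min mn h.
Qed.

Section CutSize.
Variables (R : realType) (T : choiceType) (G : graph T).
Hypothesis finG : finite_set (vertices G).

Let W := fset_set (vertices G).

Lemma mem_fset_vertices u : (u \in W) <-> vertices G u.
Proof. by rewrite /W in_fset_set // inE. Qed.

Lemma half_order (n : nat) :
  (n%:R <= 2^-1 * (graph_order G)%:R :> R)%R = (2 * n <= graph_order G).
Proof. by rewrite mulrC ler_pdivlMr // -natrM ler_nat mulnC. Qed.

Lemma finite_delete_vertices (A : set T) :
  finite_set (vertices (delete_vertices G A)).
Proof. by apply: sub_finite_set finG => u []. Qed.

Lemma finite_component (A : set T) u :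
  finite_set (component (delete_vertices G A) u).
Proof. by apply: sub_finite_set (finite_delete_vertices A) => v []. Qed.

(** A color that is constant along the surviving edges is constant on components, so no component
    outgrows its color class. *)
Lemma cut_size_le (C : eqType) (color : T -> C) (A : {fset T}) :
  A `<=` W ->
  (forall u v, adj G u v -> u \notin A -> v \notin A -> color u = color v) ->
  (forall c, 2 * #|` [fset u in W | (u \notin A) && (color u == c)]|
    <= graph_order G) ->
  cut_size (2^-1 : R) G <= #|` A|.
Proof.
move=> AW Aadj Acol; apply: bigminn_le; first by rewrite fpowersetE.
rewrite half_order.
suff : largest_component_order (delete_vertices G [set` A])
    <= (graph_order G) %/ 2 by rewrite leq_divRL // mulnC.
apply/bigmax_leqP_seq => u _ _; rewrite leq_divRL // mulnC.
apply: leq_trans (Acol (color u)); rewrite leq_mul2l /=.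
apply/fsubset_leq_card/fsubsetP => v.
rewrite in_fset_set; last exact: finite_component.
rewrite !inE /= => -[[/mem_fset_vertices Wv /negP Av] uv].
rewrite Wv Av /=; apply/eqP.
elim: uv => // [x y [xy /negP Ax /negP Ay]|x y z _ h _ h'].
  by apply/esym/Aadj.
by rewrite h'.
Qed.

(** The points outside Q form a single color class, of at most half the vertices because Q has at
    least half; inside Q the color is f. *)
Lemma two_level_cut (C : eqType) (Q : pred T) (f : T -> C) (A : {fset T}) :
  A `<=` W ->
  (forall u v, adj G u v -> u \notin A -> v \notin A -> Q u -> Q v) ->
  (forall u v, adj G u v -> u \notin A -> v \notin A -> Q u -> f u = f v) ->
  graph_order G <= 2 * #|` [fset u in W | Q u]| ->
  (forall c, 2 * #|` [fset u in W | [&& u \notin A, Q u & f u == c]]|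
    <= graph_order G) ->
  cut_size (2^-1 : R) G <= #|` A|.
Proof.
move=> AW hQ hf big small.
pose color u := if Q u then Some (f u) else None.
apply: (@cut_size_le _ color) => //.
  move=> u v uv uA vA; rewrite /color; case: ifP => Qu.
    by rewrite (hQ u v) // (hf u v).
  case: ifP => // Qv; move: Qu; rewrite (hQ v u) //; exact: adj_sym.
case=> [c|].
  apply: leq_trans (small c); rewrite leq_mul2l /=.
  apply/fsubset_leq_card/fsubsetP => u; rewrite !inE /color.
  by case: (Q u) => //=; rewrite ?andbF.
have : #|` [fset u in W | (u \notin A) && (color u == None)]|
    <= #|` W `\` [fset u in W | Q u]|.
  apply/fsubset_leq_card/fsubsetP => u; rewrite !inE /color.
  by case: (Q u) => //=; rewrite ?andbF // => /and3P[-> _ _].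
rewrite cardfsDS; last by apply/fsubsetP => u; rewrite !inE => /andP[].
by move: big; rewrite /graph_order -/W; lia.
Qed.

(** A set of fewer than m vertices is not admissible, because D then lies in one component. The
    first hypothesis covers the default value [graph_order G] of the minimum. *)
Lemma leq_cut_size m :
  m <= graph_order G ->
  (forall A : {fset T}, #|` A| < m -> exists u, exists D : {fset T},
    [/\ u \in D, {in D, forall v, vertices G v /\ v \notin A},
        {in D, forall v, reachable (delete_vertices G [set` A]) u v} &
        graph_order G < 2 * #|` D|]) ->
  m <= cut_size (2^-1 : R) G.
Proof.
move=> mG h; apply: leq_bigminn => // A _; rewrite half_order [m <= _]leqNgt.
apply: contraL => /h[u [D [uD DA Du big]]]; rewrite -ltnNge.
apply: leq_trans big _; rewrite leq_mul2l /=.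
have vD v : v \in D -> vertices (delete_vertices G [set` A]) v.
  by move=> /DA[Gv /negP].
apply: (@leq_trans
  #|` fset_set (component (delete_vertices G [set` A]) u)|).
  apply/fsubset_leq_card/fsubsetP => v vD'.
  rewrite in_fset_set; last exact: finite_component.
  by rewrite inE; split; [exact: vD|exact: Du].
rewrite /largest_component_order.
apply: (@leq_bigmax_seq _ _ xpredT
  (fun u => #|` fset_set (component (delete_vertices G [set` A]) u)|)) => //.
rewrite in_fset_set; last exact: finite_delete_vertices.
by rewrite inE; apply: vD.
Qed.

End CutSize.

(** * Reachability, and cardinalities of finite sets *)

Section Reachability.
Variables (T : choiceType) (G : graph T).

Lemma reachable_sym u v : reachable G u v -> reachable G v u.
Proof.
elim=> [x y /adj_sym|x|x y z _ yx _ zy]; first exact: rt_step.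
  exact: rt_refl.
exact: rt_trans zy yx.
Qed.

Lemma reachable_path (f : nat -> T) n :
  (forall i, i.+1 < n -> adj G (f i) (f i.+1)) ->
  forall i j, i < n -> j < n -> reachable G (f i) (f j).
Proof.
move=> fadj i j.
have h k : k < n -> reachable G (f 0) (f k).
  elim: k => [_|k IH kn]; first exact: rt_refl.
  by apply: rt_trans (IH (ltnW kn)) _; apply/rt_step/fadj.
by move=> /h hi /h; apply: rt_trans (reachable_sym hi).
Qed.

End Reachability.

Lemma cardfsM (K K' : choiceType) (A : {fset K}) (B : {fset K'}) :
  #|` A `*` B| = #|` A| * #|` B|.
Proof.
have -> : A `*` B = [fset p in [seq (x, y) | x <- A, y <- B]].
  apply/fsetP => -[x y]; rewrite in_fsetM !inE /=; apply/andP/allpairsP.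
    by move=> [xA yB]; exists (x, y).
  by move=> [[x' y'] /= [xA yB [-> ->]]].
rewrite card_fseq undup_id ?size_allpairs //.
by apply: allpairs_uniq => // -[x y] [x' y'] _ _ [-> ->].
Qed.

Lemma card_cross (K K' : choiceType) (X N : {fset K}) (Y N' : {fset K'}) :
  X `<=` N -> Y `<=` N' ->
  #|` (X `*` N') `|` (N `*` Y)| =
    #|` X| * #|` N'| + #|` N| * #|` Y| - #|` X| * #|` Y|.
Proof.
move=> /fsubsetP XN /fsubsetP YN; rewrite cardfsU !cardfsM; congr (_ - _).
rewrite -cardfsM; congr (#|` _|); apply/fsetP => -[x y].
rewrite !inE /=; apply/idP/idP.
  by move=> /andP[/andP[-> _] /andP[_ ->]].
by move=> /andP[xX yY]; rewrite xX yY XN // YN.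
Qed.

Lemma size_leq_card (T : choiceType) (A : {fset T}) (s : seq T) :
  {subset A <= s} -> #|` A| <= size s.
Proof. by move=> As; apply: uniq_leq_size => //; apply: fset_uniq. Qed.

Lemma leq_card_sub_fsetU (T : choiceType) (A B C : {fset T}) b c :
  A `<=` B `|` C -> #|` B| <= b -> #|` C| <= c -> #|` A| <= b + c.
Proof.
move=> /fsubset_leq_card/leq_trans ABC Bb Cc; apply: ABC.
by apply: leq_trans (leq_add Bb Cc); rewrite cardfsU leq_subr.
Qed.

(** * Carpet points on grid lines, and cells of a grid *)

Local Notation X v := `|v.1|%N.
Local Notation Y v := `|v.2|%N.

(** Membership in [Sgraph] with the level k forgotten, so that only signs and digits remain. *)
Definition carpet (v : int * int) : Prop :=
  [/\ (0 <= v.1)%R, (0 <= v.2)%R &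
      forall i, ~ (digit3 i v.1 = 1 /\ digit3 i v.2 = 1)].

Lemma Sgraph_carpet v : vertices Sgraph v -> carpet v.
Proof.
move=> [k _ [/andP[x0 _] /andP[y0 _] h]]; split=> // i hi.
by apply: h; exists i.
Qed.

Lemma Sgraph_adj u v : adj Sgraph u v ->
  [/\ X u <= (X v).+1, X v <= (X u).+1, Y u <= (Y v).+1 & Y v <= (Y u).+1].
Proof.
move=> [k _ [[/andP[? _] /andP[? _] _] [/andP[? _] /andP[? _] _] /=]].
by split; lia.
Qed.

(** A point is determined by its line, by the block of length 3 ^ j holding its other coordinate,
    and by the remainder of that coordinate, which has no digit 1. An unaligned window of p blocks
    leaves p + 1 choices for each of the first two and 2 ^ j for the third. *)
Lemma window_card j p a o b o' (B : {fset int * int}) :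
  {in B, forall v, [/\ carpet v, 3 ^ j %| X v + (ones j).+1,
    a <= X v + o < a + p * 3 ^ j & b <= Y v + o' < b + p * 3 ^ j]} ->
  #|` B| <= p.+1 * p.+1 * 2 ^ j.
Proof.
move=> hB; have M0 : 0 < 3 ^ j by rewrite expn_gt0.
(* This q is one more than the q of [ones_gridP], because the offset of the grid has been added to
   the coordinate. *)
pose s := [seq (Posz (3 ^ j * q - (ones j).+1), Posz (3 ^ j * te.1 + te.2)) |
  q <- iota ((a - o + (ones j).+1) %/ 3 ^ j) p.+1,
  te <- [seq (t, e) | t <- iota ((b - o') %/ 3 ^ j) p.+1, e <- even_digits j]].
have -> : p.+1 * p.+1 * 2 ^ j = size s.
  by rewrite !size_allpairs !size_iota size_even_digits mulnA.
apply: size_leq_card => v /hB[[v1 v2 cv] dX rX rY]; apply/allpairsP.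
have [q Xq] := ones_gridP dX.
have [t [e [Yte eE]]] : exists t e, Y v = 3 ^ j * t + e /\ e \in even_digits j.
  by apply: no_ones_split; apply: ones_no_ones Xq _ => i; apply: cv.
exists ((X v + (ones j).+1) %/ 3 ^ j, (t, e)); split.
- by apply: div_range => //; move: rX; clear; move: (p * _) `|v.1| => P x; lia.
- apply/allpairsP; exists (t, e); split=> //=.
  have -> : t = Y v %/ 3 ^ j.
    move: eE; rewrite mem_even_digits => /andP[ej _].
    by rewrite Yte mulnC divnMDl // divn_small // addn0.
  by apply: div_range => //; move: rY; clear; move: (p * _) `|v.2| => P x; lia.
- rewrite [_.2]/= [_.1]/= mulnC divnK // -Yte; case: (v) v1 v2 => x y /= ? ?.
  by congr pair; lia.
Qed.

Lemma window_card_swap j p a o b o' (B : {fset int * int}) :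
  {in B, forall v, [/\ carpet v, 3 ^ j %| Y v + (ones j).+1,
    a <= X v + o < a + p * 3 ^ j & b <= Y v + o' < b + p * 3 ^ j]} ->
  #|` B| <= p.+1 * p.+1 * 2 ^ j.
Proof.
move=> hB; pose sw (v : int * int) := (v.2, v.1).
have swI : injective sw by move=> [? ?] [? ?] [-> ->].
have <- : #|` [fset sw v | v in B]| = #|` B| by rewrite card_imfset.
apply: (@window_card j p b o' a o) => _ /imfsetP[v /= /hB hv ->].
have [[v1 v2 cv] dY rX rY] := hv.
by split=> //; split=> //= i [? ?]; apply: (cv i).
Qed.

Definition interior_pt M o1 o2 (v : int * int) : bool :=
  ~~ (M %| X v + o1) && ~~ (M %| Y v + o2).

Definition cell M o1 o2 (v : int * int) : nat * nat :=
  ((X v + o1) %/ M, (Y v + o2) %/ M).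

Lemma cell_adj M o1 o2 u v : 0 < M -> adj Sgraph u v ->
  interior_pt M o1 o2 u -> interior_pt M o1 o2 v ->
  cell M o1 o2 u = cell M o1 o2 v.
Proof.
move=> M0 /Sgraph_adj[? ? ? ?] /andP[? ?] /andP[? ?].
by congr pair; apply: grid_step.
Qed.

Lemma interior_refine j v :
  interior_pt (3 ^ j) (ones j).+1 (ones j).+1 v ->
  interior_pt (3 ^ j.+1) (ones j.+1).+1 (ones j.+1).+1 v.
Proof.
move=> /andP[h1 h2]; apply/andP; split.
  by apply: contra h1; apply: ones_grid_refine.
by apply: contra h2; apply: ones_grid_refine.
Qed.

(** * The upper bound on cuts of finite subgraphs of S *)

Section UpperBound.
Variables (R : realType) (G : graph (int * int)%type) (k : nat).
Hypothesis finG : finite_set (vertices G).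
Hypothesis GS : subgraph G Sgraph.
Hypothesis Gk : graph_order G <= 6 ^ k.

Let W := fset_set (vertices G).
Let n := graph_order G.

Lemma card_leq_count (P : pred (int * int)) :
  #|` [fset v in W | P v]| <= count P W.
Proof.
rewrite -size_filter; apply: size_leq_card => v.
by rewrite !inE mem_filter andbC.
Qed.

Lemma W_carpet v : v \in W -> carpet v.
Proof. by move=> /(mem_fset_vertices finG)/GS.1/Sgraph_carpet. Qed.

Lemma adj_W u v : adj G u v -> [/\ u \in W, v \in W & adj Sgraph u v].
Proof.
move=> uv; split; last exact: GS.2.
  exact/(mem_fset_vertices finG)/(adj_vertices uv).
exact/(mem_fset_vertices finG)/(adj_vertices (adj_sym uv)).
Qed.

Definition heavy M o1 o2 (c : nat * nat) : bool :=
  n < 2 * #|` [fset v in W | interior_pt M o1 o2 v && (cell M o1 o2 v == c)]|.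

Local Notation level F j := (F (3 ^ j) (ones j).+1 (ones j).+1).

Lemma cut_heavy_cell j c : level heavy j.+1 c ->
  (forall c', ~~ level heavy j c') -> cut_size (2^-1 : R) G <= 50 * 2 ^ j.
Proof.
move=> hc hj; have M0 i : 0 < 3 ^ i by rewrite expn_gt0.
pose o := (ones j.+1).+1.
(* The closure of the cell c: an edge leaving the cell ends on its boundary, which has to be deleted
   too. *)
pose near (v : int * int) :=
  (3 ^ j.+1 * c.1 <= X v + o <= 3 ^ j.+1 * c.1 + 3 ^ j.+1) &&
  (3 ^ j.+1 * c.2 <= Y v + o <= 3 ^ j.+1 * c.2 + 3 ^ j.+1).
pose A := [fset v in W | near v && ~~ level interior_pt j v].
pose Q v := level interior_pt j.+1 v && (level cell j.+1 v == c).
have nearQ u v : adj Sgraph u v -> Q u -> near v.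
  rewrite /near => /Sgraph_adj[? ? ? ?] /andP[/andP[? ?] /eqP <-].
  by apply/andP; split; apply: grid_near.
have Q_near u : Q u -> near u.
  rewrite /near => /andP[/andP[? ?] /eqP <-].
  by apply/andP; split; apply: grid_near.
have notA v : v \in W -> v \notin A -> near v -> level interior_pt j v.
  by move=> Wv; rewrite !inE Wv /= negb_and negbK => /orP[/negbTE->|].
have hA : #|` A| <= 50 * 2 ^ j.
  pose A1 := [fset v in A | 3 ^ j %| X v + (ones j).+1].
  pose A2 := [fset v in A | 3 ^ j %| Y v + (ones j).+1].
  (* A closed cell of side 3 * 3 ^ j fits in a half-open window of 4 blocks, which gives (4 + 1) ^ 2
     * 2 ^ j points per direction, hence the constant 50. *)
  have widen M z w : 0 < M -> z <= w <= z + 3 * M -> z <= w < z + 4 * M by lia.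
  have rng v : v \in A -> [/\ carpet v,
      3 ^ j.+1 * c.1 <= X v + o < 3 ^ j.+1 * c.1 + 4 * 3 ^ j &
      3 ^ j.+1 * c.2 <= Y v + o < 3 ^ j.+1 * c.2 + 4 * 3 ^ j].
    rewrite !inE => /and3P[/W_carpet cv /andP[nX nY] _]; split=> //.
      by apply: widen => //; rewrite -expnS.
    by apply: widen => //; rewrite -expnS.
  have c1 : #|` A1| <= 5 * 5 * 2 ^ j.
    apply: (@window_card j 4 (3 ^ j.+1 * c.1) o (3 ^ j.+1 * c.2) o) => v.
    by rewrite in_fset inE => /andP[/rng[]].
  have c2 : #|` A2| <= 5 * 5 * 2 ^ j.
    apply: (@window_card_swap j 4 (3 ^ j.+1 * c.1) o (3 ^ j.+1 * c.2) o) => v.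
    by rewrite in_fset inE => /andP[/rng[]].
  have /leq_trans : #|` A| <= 5 * 5 * 2 ^ j + 5 * 5 * 2 ^ j.
    apply: leq_card_sub_fsetU c1 c2.
    apply/fsubsetP => v; rewrite !inE => /and3P[-> -> nI]; rewrite nI /=.
    by move: nI; rewrite /interior_pt negb_and !negbK.
  by apply; lia.
have AW : A `<=` W by apply/fsubsetP => v; rewrite !inE => /andP[].
clearbody A; apply: leq_trans hA.
apply: (two_level_cut R finG (Q := Q) (f := level cell j)) => //.
(* A survivor in the closed cell is off the grid of level j, hence off the coarser grid of level j +
   1, so it shares the cell of its neighbour. *)
- move=> u v /adj_W[Wu Wv uv] uA vA Qu.
  have iv : level interior_pt j.+1 v.
    by apply/interior_refine/notA => //; apply: nearQ Qu.
  rewrite /Q iv /=; move/andP: Qu => [iu /eqP <-].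
  by apply/eqP/esym/cell_adj.
- move=> u v /adj_W[Wu Wv uv] uA vA Qu.
  by apply: cell_adj => //; apply: notA => //; [exact: Q_near|exact: nearQ Qu].
- exact: ltnW.
- move=> d; have := hj d; rewrite /heavy -leqNgt; apply: leq_trans.
  rewrite leq_mul2l /=; apply/fsubset_leq_card/fsubsetP => u; rewrite !inE.
  by move=> /and4P[Wu uA Qu ->]; rewrite Wu notA //; apply: Q_near.
Qed.

Lemma cut_no_heavy_cell :
  (forall c, ~~ level heavy k c) -> cut_size (2^-1 : R) G <= 10 * 2 ^ k.
Proof.
move=> hk; have M0 : 0 < 3 ^ k by rewrite expn_gt0.
(* As 6 ^ k = 3 ^ k * 2 ^ k, the average over the 3 ^ k residues is at most 2 ^ k points per
   direction. *)
have sizeW (f : int * int -> nat) : size [seq f v | v <- W] <= 3 ^ k * 2 ^ k.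
  by rewrite size_map -expnMn.
have [r1 _ hr1] := averaging M0 (sizeW (fun v => X v)).
have [r2 _ hr2] := averaging M0 (sizeW (fun v => Y v)).
move: (3 ^ k - r1) (3 ^ k - r2) hr1 hr2 => o1 o2; rewrite !count_map.
move=> /(leq_trans (card_leq_count _)) hr1 /(leq_trans (card_leq_count _)) hr2.
pose I := interior_pt (3 ^ k) o1 o2; pose f := cell (3 ^ k) o1 o2.
pose A0 := [fset v in W | ~~ I v].
have hA0 : #|` A0| <= 2 ^ k + 2 ^ k.
  apply: leq_card_sub_fsetU hr1 hr2; apply/fsubsetP => v.
  by rewrite !inE => /andP[-> /=]; rewrite /I /interior_pt negb_and !negbK.
have [[c hc]|light] := pselect (exists c, heavy (3 ^ k) o1 o2 c); last first.
  apply: (@leq_trans #|` A0|); last by apply: leq_trans hA0 _; lia.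
  apply: (cut_size_le R finG (color := f)) => //.
  - by apply/fsubsetP => v; rewrite !inE => /andP[].
  - move=> u v /adj_W[Wu Wv uv]; rewrite !inE Wu Wv !negbK => Iu Iv.
    exact: cell_adj.
  - move=> c; rewrite leqNgt; apply/negP => hc; apply: light; exists c.
    apply: leq_trans hc _; rewrite leq_mul2l /=.
    apply/fsubset_leq_card/fsubsetP => u; rewrite !inE.
    by move=> /and3P[->]; rewrite /= negbK -/I -/f => -> ->.
pose Q v := I v && (f v == c).
pose A1 := [fset v in W | Q v && (3 ^ k %| X v + (ones k).+1)].
pose A2 := [fset v in W | Q v && (3 ^ k %| Y v + (ones k).+1)].
(* Only points in the cell itself are deleted, so a half-open window of one block suffices: 4 * 2 ^
   k points per direction, and 2 + 4 + 4 = 10. *)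
have rng v : v \in W -> Q v -> [/\ carpet v,
    3 ^ k * c.1 <= X v + o1 < 3 ^ k * c.1 + 1 * 3 ^ k &
    3 ^ k * c.2 <= Y v + o2 < 3 ^ k * c.2 + 1 * 3 ^ k].
  move=> /W_carpet cv /andP[_ /eqP <-]; split=> //=.
    rewrite mulnC {2 3}(divn_eq (X v + o1) (3 ^ k)) mul1n.
    by rewrite ltn_add2l ltn_mod M0 leq_addr.
  rewrite mulnC {2 3}(divn_eq (Y v + o2) (3 ^ k)) mul1n.
  by rewrite ltn_add2l ltn_mod M0 leq_addr.
have c1 : #|` A1| <= 2 * 2 * 2 ^ k.
  apply: (@window_card k 1 (3 ^ k * c.1) o1 (3 ^ k * c.2) o2) => v.
  by rewrite !inE => /and3P[Wv Qv ?]; have [] := rng v Wv Qv.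
have c2 : #|` A2| <= 2 * 2 * 2 ^ k.
  apply: (@window_card_swap k 1 (3 ^ k * c.1) o1 (3 ^ k * c.2) o2) => v.
  by rewrite !inE => /and3P[Wv Qv ?]; have [] := rng v Wv Qv.
pose A := A0 `|` (A1 `|` A2).
have hA : #|` A| <= 10 * 2 ^ k.
  have /leq_trans : #|` A| <= 2 ^ k + 2 ^ k + (2 * 2 * 2 ^ k + 2 * 2 * 2 ^ k).
    apply: (leq_card_sub_fsetU (fsubset_refl _) hA0).
    exact: leq_card_sub_fsetU (fsubset_refl _) c1 c2.
  by apply; lia.
have notA v : v \in W -> v \notin A -> I v.
  by move=> Wv; rewrite !inE Wv /= negb_or negbK => /andP[].
have notAQ v : v \in W -> v \notin A -> Q v -> level interior_pt k v.
  move=> Wv; rewrite !inE Wv /= !negb_or => /and3P[_ + +] Qv.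
  by rewrite Qv /interior_pt => -> ->.
(* Both ends avoid [A0], so the edge cannot cross the translated grid. *)
have QQ u v : adj G u v -> u \notin A -> v \notin A -> Q u -> Q v.
  rewrite {2}/Q => /adj_W[Wu Wv uv] uA vA /andP[Iu /eqP <-].
  rewrite notA //=; apply/eqP/esym/cell_adj => //; exact: notA.
have AW : A `<=` W.
  by apply/fsubsetP => v; rewrite !inE => /orP[/andP[]|/orP[]/andP[]].
clearbody A; apply: leq_trans hA.
apply: (two_level_cut R finG (Q := Q) (f := level cell k)) => //.
- move=> u v uv uA vA Qu; have Qv := QQ _ _ uv uA vA Qu.
  by have [Wu Wv uv'] := adj_W uv; apply: cell_adj => //; apply: notAQ.
- exact: ltnW.
- move=> d; have := hk d; rewrite /heavy -leqNgt; apply: leq_trans.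
  rewrite leq_mul2l /=; apply/fsubset_leq_card/fsubsetP => u; rewrite !inE.
  by move=> /and4P[Wu uA Qu ->]; rewrite Wu notAQ.
Qed.

Lemma cut_size_upper : cut_size (2^-1 : R) G <= 25 * 2 ^ k.
Proof.
pose P j := `[< exists c, level heavy j c >].
have [[j /andP[jk Pj]]|none] := pselect (exists j, (j <= k) && P j); last first.
  apply: leq_trans (cut_no_heavy_cell _) _; last by lia.
  move=> c; apply/negP => hc; apply: none; exists k; rewrite leqnn /=.
  by apply/asboolP; exists c.
have exP : exists j, P j by exists j.
(* At level 0 the mesh is 1, so every point lies on the grid and no cell is heavy. The minimal level
   is thus some i + 1, and 50 * 2 ^ i = 25 * 2 ^ (i + 1). *)
case: (ex_minnP exP) => -[|i] /asboolP[c hc] mini.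
  move: hc; rewrite /heavy (_ : [fset v in W | _] = fset0) ?cardfs0 //.
  by apply/fsetP => v; rewrite !inE /interior_pt expn0 dvd1n andbF.
apply: leq_trans (cut_heavy_cell hc _) _.
  move=> d; apply/negP => hd.
  have /mini : P i by apply/asboolP; exists d.
  by rewrite ltnn.
have ik : i.+1 <= k by apply: leq_trans jk; apply: mini.
have : 2 ^ i.+1 <= 2 ^ k by rewrite leq_exp2l.
by rewrite expnS; lia.
Qed.

End UpperBound.

(** * The complete lines of [Gamma k] *)

(* The orientation b distinguishes vertical lines, x being the first
   coordinate, from horizontal ones, x being the second coordinate. *)
Definition pt (b : bool) (x y : nat) : int * int :=
  if b then (Posz x, Posz y) else (Posz y, Posz x).

Definition line (b : bool) (x : int) : set (int * int) :=
  if b then Defs.vline x else hline x.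

Lemma line_pt b (x y : nat) : line b x (pt b x y).
Proof. by case: b. Qed.

Lemma Gamma_ptP k b x y : vertices (Gamma k) (pt b x y) <->
  [/\ x < 3 ^ k, y < 3 ^ k &
      forall i, ~ ((x %/ 3 ^ i) %% 3 = 1 /\ (y %/ 3 ^ i) %% 3 = 1)].
Proof.
have c3 : (3 ^+ k)%R = Posz (3 ^ k) by rewrite -natz natrX.
case: b => /=; rewrite c3 !ltz_nat; split => [[? ? h]|[? ? h]]; split=> //.
- by move=> i hi; apply: h; exists i.
- by case=> i; apply: h.
- by move=> i [? ?]; apply: h; exists i.
- by case=> i [? ?]; apply: (h i).
Qed.

Lemma Gamma_pt k b u : vertices (Gamma k) u -> exists x y, u = pt b x y.
Proof.
case: u => x y [/= /andP[x0 _] /andP[y0 _] _].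
case: x y x0 y0 => [x|//] [y|//] _ _.
by case: b; [exists x, y|exists y, x].
Qed.

Lemma pt_inj b x y x' y' : pt b x y = pt b x' y' -> x = x' /\ y = y'.
Proof. by case: b => -[-> ->]. Qed.

Lemma line_ptE b (z : int) x y : line b z (pt b x y) -> z = Posz x.
Proof. by case: b => /= <-. Qed.

(** A digit 1 of x could only sit at a position i >= k, but x < 3 ^ k has digit 0 there. *)
Lemma even_digits_vertex k b x y : x \in even_digits k -> y < 3 ^ k ->
  vertices (Gamma k) (pt b x y).
Proof.
rewrite mem_even_digits => /andP[xk /no_onesP nx] yk.
apply/Gamma_ptP; split=> //.
move=> i [xi _]; have [/nx//|ki] := ltnP i k.
by move: xi; rewrite divn_small // (leq_trans xk) // leq_exp2l.
Qed.

Lemma Gamma_adj_pt k b x y :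
  vertices (Gamma k) (pt b x y) -> vertices (Gamma k) (pt b x y.+1) ->
  adj (Gamma k) (pt b x y) (pt b x y.+1).
Proof. by move=> h h'; split=> //; clear; case: b => /=; lia. Qed.

Lemma Gamma_adj_line k b x y y' : adj (Gamma k) (pt b x y) (pt b x y') ->
  y' <= y.+1.
Proof. by case=> _ _; clear; case: b => /=; lia. Qed.

(** Nothing is missing from such a line, so it is a path on 3 ^ k vertices. *)
Lemma complete_line_even_digits k b x :
  x \in even_digits k -> complete_line k (line b x).
Proof.
move=> xE; split.
- by case: b; [left|right]; exists (Posz x).
- exists (pt b x 0); split; last exact: line_pt.
  by apply: even_digits_vertex => //; rewrite expn_gt0.
move=> u v [Gu Lu] [Gv Lv].
have [xu [yu uE]] := Gamma_pt b Gu; have [xv [yv vE]] := Gamma_pt b Gv.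
subst u v.
case: (line_ptE Lu) Gu (line_ptE Lv) => <- {xu Lu} Gu [<-] {xv Lv} in Gv *.
have [_ yu3 _] := (Gamma_ptP _ _ _ _).1 Gu.
have [_ yv3 _] := (Gamma_ptP _ _ _ _).1 Gv.
apply: (reachable_path (f := pt b x) (n := 3 ^ k)) => // i ik.
split; [|exact: line_pt..].
by apply: Gamma_adj_pt; apply: even_digits_vertex => //; exact: ltnW.
Qed.

(* If the i-th digit of x is 1, then the point of height 3 ^ i is missing from
   the line, which separates the heights 0 and 2 * 3 ^ i. *)
Lemma complete_lineP k L : complete_line k L ->
  exists b x, x \in even_digits k /\ L = line b x.
Proof.
move=> [Lline [u [Gu Lu]] conn].
have [b [z Lz]] : exists b z, L = line b z.
  by case: Lline => -[z ->]; [exists true|exists false]; exists z.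
subst L; have [x [y uE]] := Gamma_pt b Gu; subst u.
have zx := line_ptE Lu; subst z; exists b, x; split=> //.
have [xk _ _] := (Gamma_ptP _ _ _ _).1 Gu.
rewrite mem_even_digits xk /=; apply/no_onesP => i ik xi.
have P3 l : 0 < 3 ^ l by rewrite expn_gt0.
have v0 : vertices (Gamma k) (pt b x 0).
  by apply/Gamma_ptP; split=> // l [_]; rewrite div0n mod0n.
have v2 : vertices (Gamma k) (pt b x (2 * 3 ^ i)).
  apply/Gamma_ptP; split=> //.
    rewrite (leq_trans (_ : _ < 3 ^ i.+1)) ?leq_exp2l //.
    by rewrite expnS ltn_pmul2r.
  move=> l [_]; have [li|il] := leqP l i.
    rewrite -(subnK li) expnD mulnA mulnK //; case: (i - l) => // d.
    by rewrite expnS mulnCA mulnC modnMl.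
  rewrite divn_small // (leq_trans (_ : _ < 3 ^ i.+1)) ?leq_exp2l //.
  by rewrite expnS ltn_pmul2r.
have := conn _ _ (conj v0 (line_pt b x 0)) (conj v2 (line_pt b x _)).
suff inv v : reachable (induced_subgraph (Gamma k) (line b x)) (pt b x 0) v ->
    exists2 y', y' < 3 ^ i & v = pt b x y'.
  by move=> /inv[y' y'i /pt_inj[_]]; move: y'i (P3 i); lia.
move=> r0; have r := clos_rt_rtn1 _ _ _ _ r0.
elim: r {r0} => [|{}v w [vw Lv Lw] _ [y' y'i vE]]; first by exists 0.
subst v; have [xw [yw wE]] := Gamma_pt b (adj_vertices (adj_sym vw)); subst w.
case: (line_ptE Lw) => xxw; subst xw; exists yw => //.
have [_ _ /(_ i) nw] := (Gamma_ptP _ _ _ _).1 (adj_vertices (adj_sym vw)).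
have := Gamma_adj_line vw.
rewrite leq_eqVlt ltnS => /orP[/eqP ywE|ywy]; last first.
  exact: leq_ltn_trans ywy y'i.
move: y'i; rewrite ywE leq_eqVlt => /orP[/eqP yi|//].
by case: nw; split=> //; rewrite ywE yi divnn P3.
Qed.

(** * Order and cut size of the graph of complete lines *)

Section CompleteLines.
Variable k : nat.

Let E : {fset int} := [fset Posz x | x in even_digits k].
Let N : {fset int} := [fset Posz x | x in iota 0 (3 ^ k)].
Let Ck := complete_lines_graph k.

Lemma card_even_abscissas : #|` E| = 2 ^ k.
Proof.
rewrite /E card_imfset /=; last by move=> ? ? [].
by rewrite -(size_even_digits k) undup_id ?uniq_even_digits.
Qed.

Lemma card_abscissas : #|` N| = 3 ^ k.
Proof.
rewrite /N card_imfset /=; last by move=> ? ? [].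
by rewrite undup_id ?iota_uniq // size_iota.
Qed.

Lemma even_abscissas_sub : E `<=` N.
Proof.
apply/fsubsetP => _ /imfsetP[x /= xE ->]; apply/imfsetP; exists x => //=.
by move: xE; rewrite mem_even_digits mem_iota => /andP[].
Qed.

(** Complete lines have no holes: the vertical ones fill the product of E and N, the horizontal ones
    that of N and E. *)
Lemma vertices_complete_lines :
  vertices Ck = [set` ((E `*` N) `|` (N `*` E))%fset]%classic.
Proof.
apply/seteqP; split=> u /=.
  move=> [L /complete_lineP[b [x [xE ->]]] [Gu Lu]].
  have [x' [y uE]] := Gamma_pt b Gu; subst u.
  case: (line_ptE Lu) => xx'; subst x'.
  have [_ yk _] := (Gamma_ptP _ _ _ _).1 Gu.
  have xE' : Posz x \in E by apply/imfsetP; exists x.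
  have yN : Posz y \in N by apply/imfsetP; exists y => //=; rewrite mem_iota.
  by rewrite !inE; case: (b); rewrite /= xE' yN ?orbT.
rewrite !inE; case: u => u v /= /orP[] /andP[].
all: move=> /imfsetP[x /= + ->] /imfsetP[y /= + ->].
  rewrite mem_iota /= => xE yk; exists (line true x).
    exact: complete_line_even_digits.
  by split=> //; apply: (@even_digits_vertex k true).
rewrite mem_iota /= => xk yE; exists (line false y).
  exact: complete_line_even_digits.
by split=> //; apply: (@even_digits_vertex k false).
Qed.

Lemma finite_complete_lines : finite_set (vertices Ck).
Proof. by rewrite vertices_complete_lines; apply: finite_fset. Qed.

Lemma order_complete_lines :
  graph_order Ck = 2 ^ k * 3 ^ k + 3 ^ k * 2 ^ k - 2 ^ k * 2 ^ k.
Proof.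
rewrite /graph_order vertices_complete_lines set_fsetK.
rewrite card_cross ?even_abscissas_sub //.
by rewrite card_even_abscissas card_abscissas.
Qed.

Lemma complete_lines_subgraph : subgraph Ck Sgraph.
Proof.
split=> [u [L _ [Gu _]]|u v [L _ [uv _ _]]]; by exists k.
Qed.

Lemma reachable_untouched (A : set (int * int)) b x : x \in even_digits k ->
  (forall y, ~ A (pt b x y)) -> forall y y', y < 3 ^ k -> y' < 3 ^ k ->
  reachable (delete_vertices Ck A) (pt b x y) (pt b x y').
Proof.
move=> xE xA; apply: reachable_path => i ik; split; [|exact: xA..].
exists (line b x); first exact: complete_line_even_digits.
split; [|exact: line_pt..].
by apply: Gamma_adj_pt; apply: even_digits_vertex => //; exact: ltnW.
Qed.

Lemma cut_size_complete_lines (R : realType) :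
  2 ^ k <= 2 * cut_size (2^-1 : R) Ck.
Proof.
(* Half of 2 ^ k, rounded up: for k = 0 the cut must be at least 1. *)
suff : (2 ^ k).+1 %/ 2 <= cut_size (2^-1 : R) Ck by lia.
have P2 : 0 < 2 ^ k by rewrite expn_gt0.
have P23 : 2 ^ k <= 3 ^ k by case: (k) => // n; rewrite leq_exp2r.
apply: leq_cut_size; first exact: finite_complete_lines.
  by rewrite order_complete_lines; move: (2 ^ k) (3 ^ k) P2 P23 => M N' *; nia.
move=> A cA.
(* A projection of A has at most as many elements as A, fewer than half of 2 ^ k, so more than half
   of the lines in each direction avoid A. *)
have card_free (f : int * int -> int) :
    2 ^ k < 2 * #|` E `\` [fset f v | v in A]|.
  have h : #|` E `&` [fset f v | v in A]| <= #|` A|.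
    exact: leq_trans (fsubset_leq_card (fsubsetIr _ _)) (leq_imfset_card _ _ _).
  rewrite cardfsD card_even_abscissas.
  by move: cA h; move: #|` A| #|` _ `&` _| => a e; lia.
move: (card_free fst) (card_free snd).
set XE := E `\` _; set YE := E `\` _ => cX cY.
have XEE : XE `<=` E by apply: fsubsetDl.
have YEE : YE `<=` E by apply: fsubsetDl.
have XEP z : z \in XE -> exists x, [/\ z = Posz x, x \in even_digits k &
    forall y, ~ [set` A]%classic (pt true x y)].
  rewrite in_fsetD => /andP[/imfsetP zA /imfsetP[x /= xE zE]].
  exists x; split=> //. by move=> y Axy; apply: zA; exists (pt true x y).
have YEP z : z \in YE -> exists y, [/\ z = Posz y, y \in even_digits k &
    forall x, ~ [set` A]%classic (pt false y x)].
  rewrite in_fsetD => /andP[/imfsetP zA /imfsetP[y /= yE zE]].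
  exists y; split=> //. by move=> x Axy; apply: zA; exists (pt false y x).
have EN x : x \in even_digits k -> x < 3 ^ k.
  by rewrite mem_even_digits => /andP[].
have NP z : z \in N -> exists2 y, z = Posz y & y < 3 ^ k.
  by move=> /imfsetP[y /=]; rewrite mem_iota => /= ? ->; exists y.
have nonempty (Z : {fset int}) : 2 ^ k < 2 * #|` Z| -> exists z, z \in Z.
  by move=> h; apply/fset0Pn; rewrite -cardfs_gt0; case: #|` Z| h.
have [z0 z0X] := nonempty _ cX; have [w0 w0Y] := nonempty _ cY.
have [x0 [z0E x0E x0A]] := XEP _ z0X; have [y0 [w0E y0E y0A]] := YEP _ w0Y.
(* D is the union of the complete lines avoiding A, rooted at a crossing of two of them. *)
exists (pt true x0 y0), ((XE `*` N) `|` (N `*` YE)); split.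
- rewrite in_fsetU !in_fsetM /= -z0E z0X -w0E.
  by rewrite (fsubsetP even_abscissas_sub) // (fsubsetP YEE).
- move=> v vD; split.
    rewrite vertices_complete_lines /= in_fsetU !in_fsetM; move: vD.
    rewrite in_fsetU !in_fsetM.
    move=> /orP[] /andP[h1 h2].
      by rewrite (fsubsetP XEE _ h1) h2.
    by rewrite h1 (fsubsetP YEE _ h2) orbT.
  move: vD; case: v => v1 v2; rewrite in_fsetU !in_fsetM /= => /orP[] /andP[].
    by move=> /XEP[x [-> _ xA]] /NP[y -> _]; apply/negP/(xA y).
  by move=> /NP[x -> _] /YEP[y [-> _ yA]]; apply/negP/(yA x).
- have y0N := EN _ y0E; have x0N := EN _ x0E.
  (* A point on a free vertical line is reached along the free horizontal line at height y0, then
     along its own line; the other case is symmetric. *)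
  case=> v1 v2; rewrite in_fsetU !in_fsetM /= => /orP[] /andP[].
    move=> /XEP[x [-> xE xA]] /NP[y -> yk].
    apply: rt_trans (_ : reachable _ (pt true x y0) _).
      exact: (reachable_untouched y0E y0A x0N (EN _ xE)).
    exact: (reachable_untouched xE xA y0N yk).
  move=> /NP[x -> xk] /YEP[y [-> yE yA]].
  apply: rt_trans (_ : reachable _ (pt true x0 y) _).
    exact: (reachable_untouched x0E x0A y0N (EN _ yE)).
  exact: (reachable_untouched yE yA x0N xk).
rewrite card_cross ?(fsubset_trans XEE even_abscissas_sub)
  ?(fsubset_trans YEE even_abscissas_sub) //.
rewrite order_complete_lines card_abscissas.
have := fsubset_leq_card XEE; have := fsubset_leq_card YEE.
rewrite card_even_abscissas.
move: cX cY P2 P23; move: (2 ^ k) (3 ^ k) (#|` XE|) (#|` YE|) => M N' a b.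
move=> aM bM M0 MN bM' aM'.
(* Excesses replace truncated differences. The claim becomes (M + p)(M + q) / 2 < M ^ 2 + N' (p +
   q), which holds since 0 < p, q <= M <= N'. *)
have [d NE] : exists d, N' = M + d by exists (N' - M); lia.
have [p pE] : exists p, 2 * a = M + p by exists (2 * a - M); lia.
have [q qE] : exists q, 2 * b = M + q by exists (2 * b - M); lia.
nia.
Qed.

End CompleteLines.

Local Close Scope nat_scope.
Local Open Scope ring_scope.

(** * From powers of 6 to all n *)

Section Exponent.
Variable R : realType.
Let alpha : R := ln 2 / ln 6.

Lemma alpha_ge0 : 0 <= alpha.
Proof. by rewrite divr_ge0 // ln_ge0 // ler1n. Qed.

Lemma powR_expn6 k : ((6 ^ k)%N%:R : R) `^ alpha = (2 ^ k)%N%:R.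
Proof.
have six : (6 : R) `^ alpha = 2.
  rewrite /powR /alpha pnatr_eq0 /= divfK ?lnK ?posrE //.
  by rewrite gt_eqF // ln_gt0 // ltr1n.
elim: k => [|k IH]; first by rewrite !expn0 powR1.
by rewrite !expnS !natrM powRM // IH six.
Qed.

Lemma ler_powR_alpha m n : (m <= n)%N -> (m%:R : R) `^ alpha <= n%:R `^ alpha.
Proof.
move=> mn; apply: ge0_ler_powR; first exact: alpha_ge0.
- by rewrite nnegrE.
- by rewrite nnegrE.
- by rewrite ler_nat.
Qed.

Lemma sep_profile_upper n : (0 < n)%N ->
  sep_profile (2^-1 : R) Sgraph n <= 50 * n%:R `^ alpha.
Proof.
move=> n0; have /andP[nl nu] := trunc_log_bounds (isT : (1 < 6)%N) n0.
(* If 6 ^ l <= n < 6 ^ (l + 1), the cut bound at level l + 1 is 25 * 2 ^ (l + 1) = 50 * 2 ^ l. *)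
apply: (@le_trans _ _ (25 * 2 ^ (trunc_log 6 n).+1)%N%:R).
  apply: ge_sup; first by case: (has_sup_sep_profile (2^-1 : R) Sgraph n).
  move=> _ [G [GS finG Gn] <-]; rewrite ler_nat.
  by apply: cut_size_upper => //; apply: leq_trans Gn (ltnW nu).
rewrite expnS mulnA natrM ler_wpM2l // -powR_expn6.
exact: ler_powR_alpha.
Qed.

Lemma sep_profile_lower n : (1 < n)%N ->
  n%:R `^ alpha <= 8 * sep_profile (2^-1 : R) Sgraph n.
Proof.
move=> n1; have n0 : (0 < n %/ 2)%N by rewrite divn_gt0.
(* With k the largest such that 6 ^ k <= n / 2, the order of C_k is at most 2 * 6 ^ k <= n, while n
   < 2 * 6 ^ (k + 1) <= 6 ^ (k + 2). The constant 8 is 2 ^ 2 for the two extra levels times 2 from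
   the cut bound. *)
have /andP[] := trunc_log_bounds (isT : (1 < 6)%N) n0.
move: (trunc_log _ _) => k nl nu.
have order_le : (graph_order (complete_lines_graph k) <= n)%N.
  rewrite order_complete_lines; apply: leq_trans (leq_subr _ _) _.
  by move: nl; rewrite -[6%N]/(2 * 3)%N expnMn; lia.
have n6 : (n <= 6 ^ k.+2)%N by move: nu; rewrite (expnS 6 k.+1); lia.
apply: le_trans (ler_powR_alpha n6) _; rewrite powR_expn6.
have cutk := cut_size_complete_lines k R.
apply: (@le_trans _ _ (8 * (cut_size (2^-1 : R) (complete_lines_graph k))%:R)).
  by rewrite -natrM ler_nat !expnS; lia.
rewrite ler_wpM2l //; apply: ub_le_sup.
  by case: (has_sup_sep_profile (2^-1 : R) Sgraph n).
exists (complete_lines_graph k) => //; split=> //.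
  exact: complete_lines_subgraph.
exact: finite_complete_lines.
Qed.

Lemma sep_profile_ge0 n : 0 <= sep_profile (2^-1 : R) Sgraph n.
Proof.
have [[c [G hG Gc]] bnd] := has_sup_sep_profile (2^-1 : R) Sgraph n.
apply: (@le_trans _ _ c); first by rewrite -Gc.
by apply: ub_le_sup bnd _ _; exists G.
Qed.

End Exponent.

Theorem theorem1 (R : realType) :
  (forall k : nat,
     (graph_order (complete_lines_graph k))%:Z = 2 * 6 ^+ k - 4 ^+ k /\
     (2 : R) ^ (k%:Z - 1) <= (cut_size (2^-1 : R) (complete_lines_graph k))%:R) /\
  asymp (sep_profile (2^-1 : R) Sgraph) (fun n : nat => n%:R `^ (ln 2 / ln 6)).
Proof.
split=> [k|].
  split.
    rewrite order_complete_lines.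
    have -> : (6 ^+ k : int) = (2 ^ k * 3 ^ k)%N%:Z.
      by rewrite -expnMn -natz natrX.
    have -> : (4 ^+ k : int) = (2 ^ k * 2 ^ k)%N%:Z.
      by rewrite -expnMn -natz natrX.
    have P2 : (0 < 2 ^ k)%N by rewrite expn_gt0.
    have P23 : (2 ^ k <= 3 ^ k)%N by case: (k) => // n; rewrite leq_exp2r.
    by move: (2 ^ k)%N (3 ^ k)%N P2 P23 => M N *; nia.
  (* The exponent is an integer, equal to -1 for k = 0, so the power is split as 2 ^ k / 2. *)
  rewrite expfzDr // exprN1 ler_pdivrMr // -natrM mulnC -exprnP -natrX ler_nat.
  exact: cut_size_complete_lines.
split; apply/eqO_exP.
  exists 50 => //; near=> n.
  rewrite !ger0_norm ?sep_profile_ge0 ?powR_ge0 //.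
  apply: sep_profile_upper; near: n; exact: nbhs_infty_gt.
exists 8 => //; near=> n.
rewrite !ger0_norm ?sep_profile_ge0 ?powR_ge0 //.
apply: sep_profile_lower; near: n; exact: nbhs_infty_gt.
Unshelve. all: by end_near.
Qed.
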